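(* Let $A$ and $B$ be finitely generated groups, set $G = A \times B$, and let $\{U_n\}_{n=1}^\infty$ be a sequence of finite index subgroups of $G$. Assume that $[A : A \cap U_n] \to \infty$ and $[B : B \cap U_n] \to \infty$ as $n \to \infty$ (where $A$ and $B$ are identified with the subgroups $A \times \{1\}$ and $\{1\} \times B$ of $G$). Then $$\lim_{n \to \infty} \frac{d(U_n) - 1}{[G : U_n]} = 0.$$
   Context: For a finitely generated group $K$, $d(K)$ denotes the least cardinality of a generating set of $K$. *)

(* Defs.v *)
From Stdlib Require Import Reals List Arith ClassicalEpsilon.
Open Scope R_scope.

Record group := Group {
  gcar :> Type;
  gmul : gcar -> gcar -> gcar;
  gone : gcar;
  ginv : gcar -> gcar;
  gmulA : forall x y z, gmul x (gmul y z) = gmul (gmul x y) z;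
  gmul1 : forall x, gmul gone x = x;
  gmulV : forall x, gmul (ginv x) x = gone
}.

Arguments gmul {g}. Arguments gone {g}. Arguments ginv {g}.

Section Prod.
Variables A B : group.
Definition pmul (x y : A * B) : A * B := (gmul (fst x) (fst y), gmul (snd x) (snd y)).
Definition pone : A * B := (gone, gone).
Definition pinv (x : A * B) : A * B := (ginv (fst x), ginv (snd x)).
Lemma pmulA x y z : pmul x (pmul y z) = pmul (pmul x y) z.
Proof. destruct x, y, z; unfold pmul; simpl; now rewrite !gmulA. Qed.
Lemma pmul1 x : pmul pone x = x.
Proof. destruct x; unfold pmul, pone; simpl; now rewrite !gmul1. Qed.
Lemma pmulV x : pmul (pinv x) x = pone.
Proof. destruct x; unfold pmul, pinv, pone; simpl; now rewrite !gmulV. Qed.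
Definition prod_group : group := Group (A * B) pmul pone pinv pmulA pmul1 pmulV.
End Prod.

Definition subset_of (G : group) := G -> Prop.

Definition is_subgroup (G : group) (H : subset_of G) : Prop :=
  H gone /\ (forall x y, H x -> H y -> H (gmul x y)) /\ (forall x, H x -> H (ginv x)).

Definition setT_g (G : group) : subset_of G := fun _ => True.
Definition setI_g (G : group) (H K : subset_of G) : subset_of G := fun x => H x /\ K x.

(* [H : K] = n, for subgroups K <= H of G: there is a surjection f from H onto
   {0,...,n-1} whose fibres are exactly the left cosets x K (x in H),
   i.e. the coset space H/K has exactly n elements. *)
Definition has_index (G : group) (H K : subset_of G) (n : nat) : Prop :=
  exists f : G -> nat,
    (forall x, H x -> (f x < n)%nat) /\
    (forall k, (k < n)%nat -> exists x, H x /\ f x = k) /\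
    (forall x y, H x -> H y -> (f x = f y <-> K (gmul (ginv x) y))).

Definition finite_index (G : group) (H K : subset_of G) : Prop :=
  exists n, has_index G H K n.

(* The index [H : K] (well defined when finite). *)
Definition index (G : group) (H K : subset_of G) : nat :=
  epsilon (inhabits 0%nat) (fun n => has_index G H K n).

Definition generates (G : group) (H : subset_of G) (S : list G) : Prop :=
  (forall s, In s S -> H s) /\
  (forall L : subset_of G, is_subgroup G L -> (forall s, In s S -> L s) ->
     forall x, H x -> L x).

Definition fin_gen (G : group) (H : subset_of G) : Prop :=
  exists S, generates G H S.

(* d(H): least cardinality of a generating set of H (well defined when H is
   finitely generated). Lists may have repetitions, but the minimum size of a
   generating list equals the minimum cardinality of a generating set. *)
Definition min_gen (G : group) (H : subset_of G) (n : nat) : Prop :=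
  (exists S, length S = n /\ generates G H S) /\
  (forall S, generates G H S -> (n <= length S)%nat).

Definition d (G : group) (H : subset_of G) : nat :=
  epsilon (inhabits 0%nat) (fun n => min_gen G H n).

Definition tends_to_infty (u : nat -> nat) : Prop :=
  forall M, exists N, forall n, (N <= n)%nat -> (M <= u n)%nat.

(* Main.v *)
(* Let P, Q be the projections of U to A and B and K = U ∩ B, which is normal
   in Q; then [G : U] = [A : P] [B : Q] [Q : K].  Lifts of Schreier generators of P
   and Q, together with elements generating K as a normal subgroup of Q, generate U.
   Since d(P) <= d(A) [A : P] and d(Q) <= d(B) [B : Q], the lifts number o([G : U]),
   and it remains to bound the normal generators of K, i.e. essentially the number of
   relators needed to present the finite group F = Q / K.  If H <= F is the
   image of V <= Q, then d(Q) [Q : V] elements plus a number e depending only on H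
   suffice, as the coset representatives of V times a subgroup V0 lifting H already
   exhaust Q modulo those.  A large F contains H of order at least M with e <= M^4:
   either cyclic of prime order (Cauchy, e = 1), or of order at most M^2 inside
   a Sylow subgroup (e <= |H|^2 by Schreier). *)

From Stdlib Require Import Reals Lra Lia List Wf_nat ClassicalEpsilon.
From mathcomp Require Import all_boot all_fingroup all_solvable zify.
Require Import Defs.
Set Implicit Arguments. Unset Strict Implicit. Unset Printing Implicit Defensive.
Local Open Scope nat_scope.

(** * Groups and generating lists *)

Section GroupLaws.
Variable G : group.
Implicit Types x y z : G.

Lemma gmulAr x y z : gmul (gmul x y) z = gmul x (gmul y z).
Proof. by rewrite gmulA. Qed.

Lemma gmulKV x y : gmul (ginv x) (gmul x y) = y.
Proof. by rewrite gmulA gmulV gmul1. Qed.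

Lemma gmulrV x : gmul x (ginv x) = gone.
Proof. by rewrite -[LHS](gmulKV (ginv x)) (gmulA _ (ginv x) x) gmulV gmul1 gmulV. Qed.

Lemma gmulr1 x : gmul x gone = x.
Proof. by rewrite -(gmulV _ x) gmulA gmulrV gmul1. Qed.

Lemma gmulVK x y : gmul x (gmul (ginv x) y) = y.
Proof. by rewrite gmulA gmulrV gmul1. Qed.

Lemma ginv_unique x y : gmul x y = gone -> y = ginv x.
Proof. by move=> xy; rewrite -[y](gmulKV x) xy gmulr1. Qed.

Lemma ginvK x : ginv (ginv x) = x.
Proof. by rewrite -(ginv_unique (gmulV _ x)). Qed.

Lemma ginv1 : ginv gone = gone :> G.
Proof. by rewrite -[LHS]gmulr1 gmulV. Qed.

Lemma ginvM x y : ginv (gmul x y) = gmul (ginv y) (ginv x).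
Proof. by rewrite -(@ginv_unique _ (gmul (ginv y) (ginv x))) // gmulAr gmulVK gmulrV. Qed.

End GroupLaws.

Hint Rewrite gmulAr gmulKV gmulVK gmulr1 gmul1 gmulV gmulrV ginvK ginv1 ginvM : grp.
Ltac gsimp := autorewrite with grp.

(** One witness is kept per entry, so the length is preserved; this is how Schreier generators and
    lifts of generators are counted. *)
Lemma list_choice T1 T2 (P : T1 -> T2 -> Prop) (l : list T1) :
  (forall x, In x l -> exists y, P x y) ->
  exists l', [/\ length l' = length l,
    forall y, In y l' -> exists2 x, In x l & P x y
    & forall x, In x l -> exists2 y, In y l' & P x y].
Proof.
elim: l => [|x l IHl] lP; first by exists nil; split.
have [|l' [sz_l' l'l ll']] := IHl; first by move=> y ly; apply: lP; right.
have [|y Pxy] := lP x; first by left.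
exists (y :: l'); split=> [|z /= [<-|/l'l[t]]|z /= [<-|/ll'[t]]] /=; first by rewrite sz_l'.
- by exists x; first by left.
- by move=> lt Ptz; exists t; first by right.
- by exists y; first by left.
by move=> l't Pzt; exists t; first by right.
Qed.

Lemma In_enum (T : finType) (x : T) : In x (enum T).
Proof.
have: x \in enum T by rewrite mem_enum.
elim: (enum T) => //= y s IHs; rewrite inE => /orP[/eqP->|/IHs]; [by left | by right].
Qed.

Section Subgroups.
Variable G : group.
Implicit Types (H K L : subset_of G) (S : list G) (x y : G).

Lemma sub1 H : is_subgroup G H -> H gone. Proof. by case. Qed.
Lemma subM H x y : is_subgroup G H -> H x -> H y -> H (gmul x y).
Proof. by case=> _ [HM _]; apply: HM. Qed.
Lemma subV H x : is_subgroup G H -> H x -> H (ginv x).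
Proof. by case=> _ [_ HV]; apply: HV. Qed.

Lemma subgroupI H K : is_subgroup G H -> is_subgroup G K ->
  is_subgroup G (setI_g G H K).
Proof.
move=> sH sK; split; [|split]; first by split; apply: sub1.
  by move=> x y [Hx Kx] [Hy Ky]; split; apply: subM.
by move=> x [Hx Kx]; split; apply: subV.
Qed.

Lemma subgroupT : is_subgroup G (setT_g G).
Proof. by []. Qed.

Definition span S : subset_of G :=
  fun x => forall L, is_subgroup G L -> (forall s, In s S -> L s) -> L x.

Lemma span_subgroup S : is_subgroup G (span S).
Proof.
split; first by move=> L sL _; apply: sub1.
split=> [x y Sx Sy|x Sx] L sL SL; first by apply: subM => //; [apply: Sx | apply: Sy].
by apply: subV => //; apply: Sx.
Qed.

Lemma span_sub S x : In x S -> span S x.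
Proof. by move=> Sx L _; apply. Qed.

Lemma span_generates S : generates G (span S) S.
Proof. by split=> [s /span_sub|L sL SL x Sx] //; apply: Sx. Qed.

(** The elements [y] such that left multiplication by [y] and by its inverse preserves [P] form a
    subgroup containing [S]. *)
Lemma generates_ind H S (P : subset_of G) : generates G H S -> P gone ->
    (forall s x, In s S -> P x -> P (gmul s x) /\ P (gmul (ginv s) x)) ->
  forall x, H x -> P x.
Proof.
move=> [_ genS] P1 PS x Hx.
pose L y := forall z, P z -> P (gmul y z) /\ P (gmul (ginv y) z).
suff: L x by move=> /(_ _ P1)[]; rewrite gmulr1.
apply: genS Hx => [|s Ss z Pz]; last exact: PS.
split; first by move=> z; gsimp.
split=> [y z Ly Lz t Pt|y Ly z /Ly[]]; last by gsimp.
split; gsimp; first by apply: (Ly _ _).1; apply: (Lz _ _).1.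
by apply: (Lz _ _).2; apply: (Ly _ _).2.
Qed.

(** [d] is picked by [epsilon], so a minimum has to exist first: it comes from the classical
    well-ordering of the naturals. *)
Lemma d_le H S : generates G H S -> (d G H <= length S)%coq_nat.
Proof.
move=> genS.
suff /(epsilon_spec (inhabits 0%nat)) [_]: exists n, min_gen G H n by apply.
pose P n := exists S', length S' = n /\ generates G H S'.
have [|n [[Pn n_min] _]] := dec_inh_nat_subset_has_unique_least_element P
    (fun n => classic _).
  by exists (length S), S.
exists n; split=> // S' genS'; apply: n_min; by exists S'.
Qed.

End Subgroups.

(** * Index *)

Section Index.
Variable G : group.
Implicit Types (H K L : subset_of G) (x y : G).

Definition transversal H K n (r : 'I_n -> G) :=
  [/\ forall i, H (r i),
      forall x, H x -> exists i, K (gmul (ginv (r i)) x)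
    & forall i j, K (gmul (ginv (r i)) (r j)) -> i = j].

Lemma has_indexE H K n : has_index G H K n ->
  exists f : G -> nat, [/\ forall x, H x -> f x < n,
    forall i : 'I_n, exists x, H x /\ f x = i,
    forall x y, H x -> H y -> f x = f y -> K (gmul (ginv x) y)
  & forall x y, H x -> H y -> K (gmul (ginv x) y) -> f x = f y].
Proof.
move=> [f [f_lt [f_surj fP]]]; exists f; split=> [x /f_lt/ltP //|i|x y Hx Hy|x y Hx Hy].
- by apply: f_surj; apply/ltP.
- by move/fP; apply.
- by move=> Kxy; apply (fP x y Hx Hy).
Qed.

(** The representative of the trivial coset is normalised to [gone], as Schreier's argument
    requires. *)
Lemma has_index_transversal H K n : is_subgroup G H -> is_subgroup G K ->
    has_index G H K n ->
  exists2 r : 'I_n -> G, transversal H K r & forall i, K (r i) -> r i = gone.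
Proof.
move=> sH sK /has_indexE[f [f_lt /fin_all_exists[r rP] f_inj f_eq]].
pose r1 i := if excluded_middle_informative (K (r i)) then gone else r i.
have r1P i : H (r1 i) /\ f (r1 i) = i.
  rewrite /r1; case: excluded_middle_informative => [Kri|_] /=; last exact: rP.
  have [Hri <-] := rP i; split; first exact: sub1.
  by apply: f_eq => //; [apply: sub1 | rewrite ginv1 gmul1].
exists r1; last first.
  by move=> i; rewrite /r1; case: excluded_middle_informative.
split=> [i|x Hx|i j Kij]; first by case: (r1P i).
  exists (Ordinal (f_lt x Hx)).
  by have [Hr fr] := r1P (Ordinal (f_lt x Hx)); apply: f_inj.
by apply: val_inj; have [Hi /= <-] := r1P i; have [Hj <-] := r1P j; apply: f_eq.
Qed.

(** The map [phi] induces a bijection from H'/K' to H/K. This moves indices between a direct product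
    and its factors. *)
Lemma has_index_map (G' : group) (phi : G' -> G) H K (H' K' : subset_of G') n :
    (forall x : G', H' x -> H (phi x)) ->
    (forall x y : G', H' x -> H' y ->
       K (gmul (ginv (phi x)) (phi y)) <-> K' (gmul (ginv x) y)) ->
    (forall h, H h -> exists2 x : G', H' x & K (gmul (ginv h) (phi x))) ->
  has_index G H K n -> has_index G' H' K' n.
Proof.
move=> phiH phiK phi_surj [f [f_lt [f_surj fP]]].
exists (fun x : G' => f (phi x)); split; first by move=> x /phiH/f_lt.
split=> [k /f_surj[h [Hh <-]]|x y Hx Hy].
  by have [x Hx Kx] := phi_surj h Hh; exists x; split=> //; apply/esym/fP; auto.
by rewrite fP; auto.
Qed.

Lemma transversal_has_index H K n (r : 'I_n -> G) :
  is_subgroup G K -> transversal H K r -> has_index G H K n.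
Proof.
move=> sK [Hr r_surj r_inj].
pose P x (i : 'I_n) := K (gmul (ginv (r i)) x).
pose f x := epsilon (inhabits 0%nat) (fun k => exists2 i, P x i & k = i :> nat).
have fP x : H x -> exists2 i, P x i & f x = i :> nat.
  move=> /r_surj[i Pxi]; apply: (epsilon_spec (inhabits 0%nat)
    (fun k => exists2 i, P x i & k = i :> nat)); by exists (nat_of_ord i), i.
have P_uniq x i j : P x i -> P x j -> i = j.
  move=> Pi Pj; apply: r_inj; move: (subM sK Pi (subV sK Pj)).
  by rewrite /P; gsimp.
exists f; split; first by move=> x /fP[i _ ->]; apply/ltP.
split=> [k /ltP lt_k|x y Hx Hy].
  exists (r (Ordinal lt_k)); split=> //.
  by have [i /r_inj -> ->] := fP _ (Hr (Ordinal lt_k)).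
have [[i Pi ->] [j Pj ->]] := (fP x Hx, fP y Hy).
split=> [/val_inj ij|Kxy].
  by move: (subM sK (subV sK Pi) Pj); rewrite ij; gsimp.
congr nat_of_ord; apply: (P_uniq y) => //.
by move: (subM sK Pi Kxy); rewrite /P; gsimp.
Qed.

Lemma has_index_le H K n N (f : G -> nat) : has_index G H K n ->
    (forall x, H x -> f x < N) ->
    (forall x y, H x -> H y -> f x = f y -> K (gmul (ginv x) y)) ->
  n <= N.
Proof.
move=> /has_indexE[g [_ /fin_all_exists[r rP] _ g_eq]] f_lt f_inj.
pose h i := Ordinal (f_lt (r i) (rP i).1).
rewrite -[n]card_ord -[N]card_ord; apply: (leq_card h) => i j [/f_inj hij].
have [[Hi gi] [Hj gj]] := (rP i, rP j).
by apply: val_inj; rewrite /= -gi -gj; apply: g_eq => //; apply: hij.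
Qed.

Lemma has_index_unique H K m n :
  has_index G H K m -> has_index G H K n -> m = n.
Proof.
move=> Hm Hn; apply/eqP; rewrite eqn_leq; apply/andP; split.
  by have [f [f_lt _ f_inj _]] := has_indexE Hn; apply: has_index_le Hm f_lt f_inj.
by have [f [f_lt _ f_inj _]] := has_indexE Hm; apply: has_index_le Hn f_lt f_inj.
Qed.

Lemma indexE H K n : has_index G H K n -> index G H K = n.
Proof.
move=> Hn; apply: has_index_unique (Hn).
by apply: (epsilon_spec (inhabits 0%nat)); exists n.
Qed.

(** Induction on [N] builds partial transversals: the label [N] contributes at most one new coset,
    added only if no earlier representative covers it. *)
Lemma finite_index_bounded H K N (f : G -> nat) : is_subgroup G K ->
    (forall x, H x -> f x < N) ->
    (forall x y, H x -> H y -> f x = f y -> K (gmul (ginv x) y)) ->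
  exists n, has_index G H K n.
Proof.
move=> sK f_lt f_inj.
suff [n [r [Hr r_inj r_surj]]]: exists n, exists r : 'I_n -> G,
    [/\ forall i, H (r i), forall i j, K (gmul (ginv (r i)) (r j)) -> i = j
      & forall x, H x -> f x < N -> exists i, K (gmul (ginv (r i)) x)].
  exists n; apply: (transversal_has_index (r := r)) => //.
  by split=> // x Hx; apply: r_surj => //; apply: f_lt.
elim: {f_lt} N => [|N [n [r [Hr r_inj r_surj]]]].
  by exists 0, (fun _ => gone); split=> // -[].
have [[y [Hy fy yN]]|noN] := classic (exists y, [/\ H y, f y = N
    & forall i, ~ K (gmul (ginv (r i)) y)]).
  exists n.+1, (fun i => if unlift ord_max i is Some j then r j else y); split.
  - by move=> i; case: unliftP.
  - move=> i j; case: unliftP => [i' ->|->]; case: unliftP => [j' ->|->] //.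
    + by move/r_inj ->.
    + by move/yN.
    + by move/(subV sK); gsimp => /yN.
  move=> x Hx; rewrite ltnS leq_eqVlt => /orP[/eqP fx|/(r_surj x Hx)[i Ki]].
    by exists ord_max; rewrite unlift_none; apply: f_inj; rewrite ?fx.
  by exists (lift ord_max i); rewrite liftK.
exists n, r; split=> // x Hx; rewrite ltnS leq_eqVlt => /orP[/eqP fx|]; last exact: r_surj.
apply: NNPP => no_i; apply: noN; exists x; split=> // i Ki.
by apply: no_i; exists i.
Qed.

Lemma has_index_mul H K L n m : is_subgroup G H -> is_subgroup G K ->
    is_subgroup G L -> (forall x, K x -> H x) -> (forall x, L x -> K x) ->
  has_index G H K n -> has_index G K L m -> has_index G H L (n * m).
Proof.
move=> sH sK sL KH LK /has_index_transversal[] // r [Hr r_surj r_inj] _.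
move=> /has_index_transversal[] // q [Kq q_surj q_inj] _.
pose rq (p : 'I_n * 'I_m) := gmul (r p.1) (q p.2).
have cT : #|{: 'I_n * 'I_m}| = n * m by rewrite card_prod !card_ord.
rewrite -cT; apply: (transversal_has_index (r := fun i => rq (enum_val i))) => //; split.
- by move=> i; apply: subM => //; apply: KH.
- move=> x /r_surj[i /q_surj[j Lj]]; exists (enum_rank (i, j)).
  by rewrite enum_rankK /rq /=; move: Lj; gsimp.
move=> i j; set u := enum_val i; set v := enum_val j => Luv.
apply: enum_val_inj; rewrite -/u -/v.
have uv1 : u.1 = v.1.
  apply: r_inj; move: (subM sK (Kq u.2) (subM sK (LK _ Luv) (subV sK (Kq v.2)))).
  by rewrite /rq; gsimp.
have uv2 : u.2 = v.2 by apply: q_inj; move: Luv; rewrite /rq uv1; gsimp.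
by rewrite [u]surjective_pairing uv1 uv2 -surjective_pairing.
Qed.

(** A labelling that separates the cosets of [L] bounds both intermediate indices; uniqueness of the
    index then gives the product formula. *)
Lemma has_index_tower H K L N : is_subgroup G H -> is_subgroup G K ->
    is_subgroup G L -> (forall x, K x -> H x) -> (forall x, L x -> K x) ->
    has_index G H L N ->
  exists n m, [/\ has_index G H K n, has_index G K L m & N = n * m].
Proof.
move=> sH sK sL KH LK HL; have [f [f_lt _ f_inj _]] := has_indexE HL.
have [|x y Hx Hy fxy|n Hn] := @finite_index_bounded H K N f sK.
- exact: f_lt.
- by apply: LK; apply: f_inj.
have [|x y Kx Ky fxy|m Hm] := @finite_index_bounded K L N f sL.
- by move=> x /KH/f_lt.
- by apply: f_inj fxy; apply: KH.
exists n, m; split=> //; apply: has_index_unique HL _.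
exact: has_index_mul Hn Hm.
Qed.

End Index.

(** * Schreier generators *)

Section Schreier.
Variable G : group.
Implicit Types (C H K L Q V : subset_of G) (S : list G) (x y : G).

(** Core of Schreier's argument: the union of the cosets [r i] C is stable under the generators and
    their inverses, so it is all of [Q]. If an element of [V] lies in [r i] C, then [r i] is in [V],
    hence trivial. *)
Lemma transversal_closed Q V C S m (r : 'I_m -> G) :
    is_subgroup G Q -> is_subgroup G V -> is_subgroup G C ->
    (forall x, V x -> Q x) -> (forall x, C x -> V x) ->
    generates G Q S -> transversal Q V r -> (forall i, V (r i) -> r i = gone) ->
    (forall s i, In s S -> exists j, C (gmul (ginv (r j)) (gmul s (r i)))) ->
  forall x, V x -> C x.
Proof.
move=> sQ sV sC VQ CV genS [Qr r_surj r_inj] r1 stepC.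
suff W x : Q x -> exists i, C (gmul (ginv (r i)) x).
  move=> x Vx; have [i Ci] := W x (VQ x Vx).
  have: V (r i) by move: (subM sV Vx (subV sV (CV _ Ci))); gsimp.
  by move/r1=> ri; move: Ci; rewrite ri; gsimp.
move: x; apply: (generates_ind genS) => [|s x Ss [j Cj]].
  have [i Vi] := r_surj gone (sub1 sQ); exists i.
  rewrite r1; first by gsimp; apply: sub1.
  by move: (subV sV Vi); gsimp.
split.
  have [k Ck] := stepC s j Ss; exists k.
  by move: (subM sC Ck Cj); gsimp.
have Qs : Q s by case: genS => + _; apply.
(* For an inverse generator, start from the [i] with s^-1 [r j] in [r i] V. Then s [r i] lies in
   [r j] V and in some [r k] C, which forces k = j. *)
have [|i Vi] := r_surj (gmul (ginv s) (r j)); first by apply: subM => //; apply: subV.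
have [k Ck] := stepC s i Ss; exists i.
have kj : k = j by apply: r_inj; move: (subM sV (CV _ Ck) Vi); gsimp.
by move: (subM sC (subV sC Ck) Cj); rewrite kj; gsimp.
Qed.

Lemma transversal_step Q V S m (r : 'I_m -> G) s i :
    is_subgroup G Q -> generates G Q S -> transversal Q V r -> In s S ->
  exists j, V (gmul (ginv (r j)) (gmul s (r i))).
Proof.
move=> sQ [SQ _] [Qr r_surj _] /SQ Qs.
by apply: r_surj; apply: subM.
Qed.

Lemma length_enum_ord m : length (enum 'I_m) = m.
Proof. exact: size_enum_ord. Qed.

(** The list holds one element r_j^-1 s r_i per pair (s, i). Any subgroup [L] containing it meets
    the conditions of [transversal_closed] through its intersection with [V]. *)
Lemma schreier Q V S m : is_subgroup G Q -> is_subgroup G V ->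
    (forall x, V x -> Q x) -> generates G Q S -> has_index G Q V m ->
  exists2 R, length R = length S * m & generates G V R.
Proof.
move=> sQ sV VQ genS /has_index_transversal[] // r rT r1.
pose P (p : G * 'I_m) v :=
  V v /\ exists j, v = gmul (ginv (r j)) (gmul p.1 (r p.2)).
have [[s i] /in_prod_iff[Ss _]|R [szR RP PR]] := @list_choice _ _ P (list_prod S (enum 'I_m)).
  have [j Vj] := transversal_step i sQ genS rT Ss.
  by exists (gmul (ginv (r j)) (gmul s (r i))); split; last by exists j.
exists R; first by rewrite szR length_prod length_enum_ord.
split=> [v /RP[p _ []//]|L sL RL x Vx].
pose C := setI_g G L V.
suff: C x by case.
have sC : is_subgroup G C by apply: subgroupI.
apply: (transversal_closed sQ sV sC VQ _ genS rT r1) Vx => [y []//|s i Ss].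
have /PR[v Rv [Vv [j vE]]]: In (s, i) (list_prod S (enum 'I_m)).
  by apply/in_prod => //; apply: In_enum.
by exists j; rewrite -vE; split; first exact: RL.
Qed.

(* [K] is the normal closure in [Q] of the [K]-parts of the Schreier generators
   of [V] and of generators of [V0 `&` K]: the coset representatives of [V]
   times [V0] times this closure already exhaust [Q]. *)
Lemma normal_generators Q V V0 K S E m :
    is_subgroup G Q -> is_subgroup G V -> is_subgroup G V0 -> is_subgroup G K ->
    (forall x, V x -> Q x) -> (forall x, V0 x -> V x) -> (forall x, K x -> V x) ->
    (forall q x, Q q -> K x -> K (gmul q (gmul x (ginv q)))) ->
    (forall x, V x -> exists2 y, V0 y & K (gmul (ginv y) x)) ->
    (forall x, In x E -> K x) -> (forall x, V0 x -> K x -> span E x) ->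
    generates G Q S -> has_index G Q V m ->
  exists R, [/\ length R = length S * m + length E, forall x, In x R -> K x
    & forall L, is_subgroup G L ->
      (forall q x, Q q -> L x -> L (gmul q (gmul x (ginv q)))) ->
      (forall x, In x R -> L x) -> forall x, K x -> L x].
Proof.
move=> sQ sV sV0 sK VQ V0V KV normK V_V0K EK V0K genS /has_index_transversal[] // r rT r1.
(* Each Schreier generator of [V] is split as [y] times [k] with [y] in [V0] and [k] in [K]; only
   [k] is kept. *)
pose P (p : G * 'I_m) k := K k /\ exists j y,
  V0 y /\ gmul (ginv (r j)) (gmul p.1 (r p.2)) = gmul y k.
have [[s i] /in_prod_iff[Ss _]|R [szR RP PR]] := @list_choice _ _ P (list_prod S (enum 'I_m)).
  have [j Vj] := transversal_step i sQ genS rT Ss.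
  have [y V0y Ky] := V_V0K _ Vj; eexists; split; first exact: Ky.
  by exists j, y; split=> //; gsimp.
exists (R ++ E)%list; split.
- by rewrite length_app szR length_prod length_enum_ord.
- by move=> x /in_app_iff[/RP[p _ []]|/EK].
move=> L sL normL RL x Kx.
(* [C] is the product of [V0] and the intersection of [L] with [K]. It is a subgroup because [Q]
   normalises that intersection. *)
pose C y := exists2 v, V0 v & setI_g G L K (gmul (ginv v) y).
have sLK := subgroupI sL sK.
have normLK q y : Q q -> setI_g G L K y -> setI_g G L K (gmul q (gmul y (ginv q))).
  by move=> Qq [Ly Ky]; split; [apply: normL | apply: normK].
have sC : is_subgroup G C.
  split; first by exists gone; [apply: sub1 | gsimp; apply: sub1].
  split=> [y z [v V0v LKv] [w V0w LKw]|y [v V0v LKv]].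
    exists (gmul v w); first exact: subM.
    have /(normLK (ginv w)) := LKv; move/(_ (VQ _ (V0V _ (subV sV0 V0w)))).
    by move/(subM sLK)/(_ LKw); gsimp.
  exists (ginv v); first exact: subV.
  by have := normLK v _ (VQ _ (V0V _ V0v)) (subV sLK LKv); gsimp.
have CV y : C y -> V y.
  by move=> [v V0v [_ /KV]] /(subM sV (V0V _ V0v)); gsimp.
have [v V0v [Lv Kv]] : C x.
  apply: (transversal_closed sQ sV sC VQ CV genS rT r1) (KV _ Kx) => s i Ss.
  have /PR[k Rk [Kk [j [v [V0v jE]]]]]: In (s, i) (list_prod S (enum 'I_m)).
    by apply/in_prod => //; apply: In_enum.
  exists j, v => //; rewrite jE gmulKV; split=> //.
  by apply: RL; apply/in_app_iff; left.
(* Both [x] and its second factor lie in [K], so [v] lies in [V0] and [K], where [E] takes over. *)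
have: L v.
  apply: (V0K v V0v) => // [|y Ey]; last by apply: RL; apply/in_app_iff; right.
  by move: (subM sK Kx (subV sK Kv)); gsimp.
by move=> /(subM sL)/(_ Lv); gsimp.
Qed.

End Schreier.

(** * Finite groups *)

(** [n] is the product of its [p]-parts. Indices above [M] contribute 1, and each of the M + 1
    indices from 0 to [M] contributes at most [M]. *)
Lemma partn_lt_bound n M : 0 < n ->
    (forall p, prime p -> p %| n -> p <= M) ->
    (forall p, prime p -> n`_p < M) ->
  n <= M ^ M.+1.
Proof.
move=> n_gt0 le_pM lt_npM.
have M_gt0 : 0 < M := leq_trans (ltn0Sn _) (lt_npM 2 isT).
have leMn : n <= maxn n M by apply: leq_maxl.
rewrite -[n in n <= _]partnT // (widen_partn _ leMn) /=.
have le_M : M.+1 <= (maxn n M).+1 by rewrite ltnS leq_maxr.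
rewrite (eq_bigl xpredT) // (@big_cat_nat _ _ _ M.+1) //=.
rewrite [X in _ * X]big_nat_cond [X in _ * X]big1 ?muln1.
  rewrite big_mkord -[X in M ^ X]card_ord -prod_nat_const; apply: leq_prod => p _.
  have [p_pr|p_npr] := boolP (prime p); last by rewrite lognE (negbTE p_npr) expn0.
  by rewrite -p_part ltnW ?lt_npM.
move=> p /andP[/andP[lt_Mp _] _]; rewrite lognE; case: and3P => // -[p_pr _ p_n].
by have := le_pM p p_pr p_n; rewrite leqNgt lt_Mp.
Qed.

(** A prime divisor above [M] gives a subgroup of prime order by Cauchy. Otherwise some [p]-part is
    at least [M] by [partn_lt_bound], and a Sylow subgroup contains a subgroup of order p^r for the
    least r with p^r >= M; minimality and p <= M give p^r <= M^2. *)
Lemma exists_medium_subgroup (gT : finGroupType) (G : {group gT}) M :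
    0 < M -> M ^ M.+1 < #|G| ->
  exists H : {group gT}, [/\ H \subset G, M <= #|H|
    & prime #|H| \/ #|H| <= M * M].
Proof.
move=> M_gt0 G_large.
have [[p [p_pr p_G lt_Mp]]|small_p] := classic (exists p, [/\ prime p, p %| #|G| & M < p]).
  have [x Gx ox] := Cauchy p_pr p_G; exists <[x]>%G.
  by rewrite cycle_subG -orderE ox; split=> //; [apply: ltnW | left].
have le_pM p : prime p -> p %| #|G| -> p <= M.
  by move=> p_pr p_G; rewrite leqNgt; apply/negP=> lt_Mp; apply: small_p; exists p.
have [[p [p_pr le_M]]|small_part] := classic (exists p, prime p /\ M <= #|G|`_p); last first.
  suff: #|G| <= M ^ M.+1 by rewrite leqNgt G_large.
  apply: partn_lt_bound => // p p_pr; rewrite ltnNge; apply/negP=> le_M.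
  by apply: small_part; exists p.
have [P sylP] := Sylow_exists p G.
have pP := pHall_pgroup sylP.
have oP : #|P| = (p ^ logn p #|P|)%N by rewrite -p_part part_pnat_id.
have [|r le_Mr min_r] := @ex_minnP (fun r => M <= p ^ r).
  by exists (logn p #|P|); rewrite -oP (card_Hall sylP).
have le_r : r <= logn p #|P| by apply: min_r; rewrite -oP (card_Hall sylP).
have [Q [sQP _ oQ]] := normal_pgroup pP (normal_refl P) le_r.
exists Q; rewrite oQ; split=> //; first exact: subset_trans sQP (pHall_sub sylP).
right; case: r le_Mr min_r {le_r oQ} => [|r] le_Mr min_r.
  by rewrite expn0 muln_gt0 M_gt0.
have lt_r : p ^ r < M by rewrite ltnNge; apply/negP => /min_r; rewrite ltnn.
rewrite expnS leq_mul ?(ltnW lt_r) // le_pM //; apply/negPn/negP => p_nG.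
have p_r : 0 < p ^ r by rewrite expn_gt0 prime_gt0.
by move: le_M; rewrite p_part lognE (negbTE p_nG) !andbF leqNgt (leq_ltn_trans p_r).
Qed.

(** * Normal generators of a finite index normal subgroup *)

Section Quotient.
Variables (G : group) (Q K : subset_of G).
Hypotheses (sQ : is_subgroup G Q) (sK : is_subgroup G K).
Hypothesis KQ : forall x, K x -> Q x.
Hypothesis normK : forall q x, Q q -> K x -> K (gmul q (gmul x (ginv q))).

(* [Q] acts on the cosets of [K] by right translation, since MathComp permutations
   compose from left to right. *)
Lemma quotient_perm n : has_index G Q K n ->
  exists phi : G -> 'S_n,
    (forall x y, Q x -> Q y -> phi (gmul x y) = (phi x * phi y)%g) /\
    (forall x, Q x -> phi x = 1%g <-> K x).
Proof.
move=> /has_index_transversal[] // r [Qr r_surj r_inj] r1.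
pose P x (s : 'S_n) := forall i, K (gmul (ginv (r (s i))) (gmul (r i) x)).
have normK' q x : Q q -> K x -> K (gmul (ginv q) (gmul x q)).
  by move=> Qq Kx; have := normK (subV sQ Qq) Kx; gsimp.
have r_eq x i j : K (gmul (ginv (r i)) x) -> K (gmul (ginv (r j)) x) -> i = j.
  move=> Ki Kj; apply: r_inj.
  by move: (subM sK Ki (subV sK Kj)); gsimp.
have Pex x : Q x -> exists s, P x s.
  move=> Qx.
  have /fin_all_exists[t tP] i : exists j, K (gmul (ginv (r j)) (gmul (r i) x)).
    by apply: r_surj; apply: subM.
  (* Two indices with the same image give a conjugate by [x] of r_i^-1 r_j in [K]; normality removes
     the conjugation. *)
  have t_inj : injective t.
    move=> i j tij; apply: r_inj.
    move: (subM sK (subV sK (tP i)) (tP j)); rewrite tij => Kx.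
    by have := normK Qx Kx; gsimp.
  by exists (perm t_inj) => i; rewrite permE.
pose phi x := epsilon (inhabits 1%g) (P x).
have phiP x : Q x -> P x (phi x) by move=> /Pex; apply: epsilon_spec.
exists phi; split=> [x y Qx Qy|x Qx].
  apply/permP=> i; rewrite permM.
  apply: r_eq (phiP _ (subM sQ Qx Qy) i) _.
  have Kj := phiP y Qy (phi x i); have Ki := normK' _ _ Qy (phiP x Qx i).
  by move: (subM sK Kj Ki); gsimp.
split=> [phi1|Kx].
  have [i Ki] := r_surj gone (sub1 sQ).
  have ri : r i = gone by apply: r1; move: (subV sK Ki); gsimp.
  by have := phiP x Qx i; rewrite phi1 perm1 ri; gsimp.
apply/permP=> i; rewrite perm1; apply: r_eq (phiP _ Qx i) _.
by have := normK' _ _ (Qr i) Kx; gsimp.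
Qed.

(** * Preimages of subgroups of the finite quotient *)

Section Morphism.
Variables (gT : finGroupType) (phi : G -> gT).
Hypothesis phiM : forall x y, Q x -> Q y -> phi (gmul x y) = (phi x * phi y)%g.
Hypothesis kerphi : forall x, Q x -> phi x = 1%g <-> K x.

Lemma morph1 : phi gone = 1%g.
Proof. by apply (kerphi (sub1 sQ)); apply: sub1. Qed.

Lemma morphV x : Q x -> phi (ginv x) = (phi x)^-1%g.
Proof.
move=> Qx; apply: (mulgI (phi x)).
by rewrite mulgV -phiM ?gmulrV ?morph1 //; apply: subV.
Qed.

Lemma morph_eq x y : Q x -> Q y -> phi x = phi y <-> K (gmul (ginv x) y).
Proof.
move=> Qx Qy; rewrite -(kerphi (subM sQ (subV sQ Qx) Qy)) (phiM (subV sQ Qx) Qy).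
rewrite morphV //; split=> [->|/eqP]; first by rewrite mulVg.
by rewrite -eq_invg_mul invgK => /eqP.
Qed.

Definition image_set : {set gT} := [set z | excluded_middle_informative (exists2 x, Q x & phi x = z)].

Lemma image_setP z : reflect (exists2 x, Q x & phi x = z) (z \in image_set).
Proof. by rewrite inE; case: excluded_middle_informative => ?; constructor. Qed.

Lemma image_group_set : group_set image_set.
Proof.
apply/group_setP; split; first by apply/image_setP; exists gone; [apply: sub1 | apply: morph1].
move=> _ _ /image_setP[x Qx <-] /image_setP[y Qy <-]; apply/image_setP.
by exists (gmul x y); [apply: subM | apply: phiM].
Qed.

Definition preim (H : {set gT}) : subset_of G := fun x => Q x /\ phi x \in H.

Lemma preim_subgroup (H : {group gT}) : is_subgroup G (preim H).
Proof.
split; first by split; [apply: sub1 | rewrite morph1].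
split=> [x y [Qx Hx] [Qy Hy]|x [Qx Hx]]; first by split; [apply: subM | rewrite phiM // groupM].
by split; [apply: subV | rewrite morphV // groupV].
Qed.

Lemma sub_preim (H : {group gT}) x : K x -> preim H x.
Proof. by move=> Kx; split; [apply: KQ | rewrite ((kerphi (KQ Kx)).2 Kx)]. Qed.

(** One lift per element of [H] represents the cosets of [K], so [K] has index [#|H|] in the
    preimage. *)
Lemma preim_transversal (H : {group gT}) : H \subset image_set ->
  exists2 r : 'I_#|H| -> G, transversal (preim H) K r & forall i, phi (r i) = enum_val i.
Proof.
move=> /subsetP sH.
have /fin_all_exists[r rP] (i : 'I_#|H|) : exists x, Q x /\ phi x = enum_val i.
  by have /sH/image_setP[x] := enum_valP i; exists x.
exists r => [|i]; last by case: (rP i).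
have Qr i := (rP i).1; have phir i := (rP i).2.
split=> [i|x [Qx Hx]|i j]; first by split; rewrite ?phir //; apply: enum_valP.
  exists (enum_rank_in (group1 H) (phi x)); apply/(morph_eq (Qr _) Qx).
  by rewrite phir enum_rankK_in.
by move=> /(morph_eq (Qr i) (Qr j)); rewrite !phir => /enum_val_inj.
Qed.

(** [V0] is generated by one lift of each element of [H]. Its intersection with [K] has index [#|H|]
    in it, so Schreier's bound is [#|H|] squared. *)
Lemma preim_span_finite (H : {group gT}) : H \subset image_set ->
  exists V0 E, [/\ is_subgroup G V0, (forall x, V0 x -> preim H x),
    (forall x, preim H x -> exists2 y, V0 y & K (gmul (ginv y) x)),
    (forall x, In x E -> K x) /\ (forall x, V0 x -> K x -> span E x)
    & length E = #|H| * #|H|].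
Proof.
move=> /preim_transversal[r [Hr r_surj r_inj] _].
pose X := map r (enum 'I_#|H|); pose V0 := span X.
have sV0 : is_subgroup G V0 := span_subgroup X.
have V0r i : V0 (r i) by apply: span_sub; apply: in_map; apply: In_enum.
have V0H x : V0 x -> preim H x.
  by apply=> [|_ /in_map_iff[i [<- _]]]; first exact: preim_subgroup.
have sV0K : is_subgroup G (setI_g G V0 K) by apply: subgroupI.
have V0K_index : has_index G V0 (setI_g G V0 K) #|H|.
  apply: (transversal_has_index (r := r) sV0K); split=> // [x V0x|i j []]; last by move=> _ /r_inj.
  have [i Ki] := r_surj x (V0H x V0x); exists i; split=> //.
  by apply: (subM sV0 (subV sV0 _)).
have [E szE [V0E genE]] := schreier sV0 sV0K (fun x => @proj1 _ _) (span_generates X) V0K_index.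
exists V0, E; split=> //.
- by move=> x /r_surj[i Ki]; exists (r i).
- by split=> [x /V0E[]|x V0x Kx L sL LE] //; apply: genE.
by rewrite szE length_map length_enum_ord.
Qed.

(** [V0] is generated by a single lift [x] of [c], and its intersection with [K] by the power of [x]
    with exponent the order of [c]. *)
Lemma preim_span_cyclic (c : gT) : c \in image_set ->
  exists V0 E, [/\ is_subgroup G V0, (forall x, V0 x -> preim <[c]>%g x),
    (forall x, preim <[c]>%g x -> exists2 y, V0 y & K (gmul (ginv y) x)),
    (forall x, In x E -> K x) /\ (forall x, V0 x -> K x -> span E x)
    & length E = 1].
Proof.
move=> /image_setP[x Qx phix].
pose X := x :: nil; pose V0 := span X.
pose pw i := iter i (gmul x) gone.
have sV0 : is_subgroup G V0 := span_subgroup X.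
have V0x : V0 x by apply: span_sub; left.
have V0pw i : V0 (pw i) by elim: i => [|i IHi]; [apply: sub1 | apply: (subM sV0)].
have V0H y : V0 y -> preim <[c]>%g y.
  apply=> [|_ [<-|//]]; first exact: preim_subgroup.
  by split; rewrite // phix cycle_id.
have Qpw i : Q (pw i) by case: (V0H _ (V0pw i)).
have phi_pw i : phi (pw i) = (c ^+ i)%g.
  by elim: i => [|i IHi]; rewrite ?morph1 //= phiM // phix IHi expgS.
have o_c : 0 < #[c]%g := order_gt0 c.
have Kp : K (pw #[c]%g) by apply (kerphi (Qpw _)); rewrite phi_pw expg_order.
have r_surj y : preim <[c]>%g y -> exists i : 'I_#[c]%g, K (gmul (ginv (pw i)) y).
  move=> [Qy /cyclePmin[i lt_i yE]]; exists (Ordinal lt_i).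
  by apply/(morph_eq (Qpw _) Qy); rewrite phi_pw yE.
have r_inj (i j : 'I_#[c]%g) : K (gmul (ginv (pw i)) (pw j)) -> i = j.
  move=> /(morph_eq (Qpw i) (Qpw j))/eqP.
  by rewrite !phi_pw eq_expg_mod_order !modn_small // => /eqP/val_inj.
have sV0K : is_subgroup G (setI_g G V0 K) by apply: subgroupI.
exists V0, (pw #[c]%g :: nil); split=> //.
- by move=> y /r_surj[i Ki]; exists (pw i).
split=> [y [<-|]|y V0y Ky] //.
apply: (transversal_closed (V := setI_g G V0 K) (r := fun i : 'I_#[c]%g => pw i)
  sV0 sV0K (span_subgroup _) _ _ (span_generates X)) => //.
- by move=> z [].
- by move=> z /(_ _ sV0K); apply=> s [<-|].
- split=> // [z V0z|i j [_ /r_inj] //].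
  by have [i Ki] := r_surj z (V0H z V0z); exists i; split=> //; apply: (subM sV0 (subV sV0 _)).
- move=> i [_ Ki]; suff -> : i = Ordinal o_c by [].
  by apply: r_inj; move: (subV sK Ki) => /=; gsimp.
(* Multiplication by [x] shifts the exponent by one; past the last representative it returns to
   exponent 0 and leaves the generator [pw #[c]] as the [C]-part. *)
move=> s i [<-|//]; have [lt_i|ge_i] := ltnP i.+1 #[c]%g.
  by exists (Ordinal lt_i); rewrite /= gmulV; apply: sub1 (span_subgroup _).
have iE : i.+1 = #[c]%g by apply/eqP; rewrite eqn_leq ge_i ltn_ord.
exists (Ordinal o_c); rewrite /= ginv1 gmul1.
by apply: span_sub; left; apply: (congr1 pw (esym iE)).
Qed.

End Morphism.

(** [h] is the order of the subgroup found by [exists_medium_subgroup], and [m] is the index of its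
    preimage [V] in [Q]. Replacing [f] by [m] saves a factor of at least [M] unless [f] is bounded
    in terms of [M]. *)
Lemma normal_generators_bound S f M :
    0 < M -> generates G Q S -> has_index G Q K f ->
  exists m h R, [/\ f = m * h, M <= h \/ f <= M ^ M.+1,
    length R <= length S * m + (M * M) * (M * M), forall x, In x R -> K x
    & forall L, is_subgroup G L ->
      (forall q x, Q q -> L x -> L (gmul q (gmul x (ginv q)))) ->
      (forall x, In x R -> L x) -> forall x, K x -> L x].
Proof.
move=> M_gt0 genS Kf.
have [f_small|f_large] := leqP f (M ^ M.+1).
  (* For small [f] take [V] = [K], [V0] trivial and [E] empty: the result is the Schreier generators
     of [K], with [m] = [f] and [h] = 1. *)
  have s1 : is_subgroup G (eq gone) by split=> //; split=> [x y <- <-|x <-]; gsimp.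
  have K1 x : gone = x -> K x by move=> <-; apply: sub1.
  have K_1K x : K x -> exists2 y, gone = y & K (gmul (ginv y) x).
    by exists gone => //; gsimp.
  have span1 x : gone = x -> K x -> span nil x.
    by move=> <- _; apply: sub1 (span_subgroup _).
  have nilK (x : G) : In x nil -> K x by [].
  have [R [szR RK genR]] := normal_generators sQ sK s1 sK KQ K1 (fun x => id)
    normK K_1K nilK span1 genS Kf.
  exists f, 1, R; rewrite muln1; split=> //; first by right.
  by rewrite szR /=; lia.
have [phi [phiM kerphi]] := quotient_perm Kf.
pose Gr := fingroup.Group (image_group_set phiM kerphi).
have sGr : Gr \subset image_set phi by [].
have cGr : #|Gr| = f.
  have [r rT _] := preim_transversal phiM kerphi sGr.
  apply: has_index_unique Kf; apply: (transversal_has_index (r := r)) => //.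
  case: rT => Hr r_surj r_inj; split=> [i|x Qx|//]; first by case: (Hr i).
  by apply: r_surj; split=> //; apply/image_setP; exists x.
have [H [sHG le_MH smallH]] : exists H : {group 'S_f}, [/\ H \subset Gr, M <= #|H|
    & prime #|H| \/ #|H| <= M * M] by apply: exists_medium_subgroup; rewrite ?cGr.
pose V := preim phi H.
have sV : is_subgroup G V := preim_subgroup phiM kerphi H.
have KV x : K x -> V x := @sub_preim _ _ kerphi H x.
have VQ x : V x -> Q x by case.
have [m [h [Vm Vh fE]]] := has_index_tower sQ sV sK VQ KV Kf.
have hE : h = #|H|.
  have [r rT _] := preim_transversal phiM kerphi sHG.
  by apply: has_index_unique Vh _; apply: (transversal_has_index (r := r)).
suff [V0 [E [sV0 V0V V_V0K [EK V0K] szE]]] : exists V0 E, [/\ is_subgroup G V0, (forall x, V0 x -> V x),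
    (forall x, V x -> exists2 y, V0 y & K (gmul (ginv y) x)),
    (forall x, In x E -> K x) /\ (forall x, V0 x -> K x -> span E x)
    & length E <= M * M * (M * M)].
  have [R [szR RK genR]] := normal_generators sQ sV sV0 sK VQ V0V KV normK V_V0K EK V0K genS Vm.
  by exists m, h, R; split=> //; [left; rewrite hE | rewrite szR leq_add2l].
(* Prime order makes [H] cyclic, with one element in [E]; otherwise [E] has [#|H|] squared elements,
   at most M^4. *)
case: smallH => [/prime_cyclic/cyclicP[c Hc]|leH].
  have [|V0 [E [sV0 V0V V_V0K EK szE]]] := @preim_span_cyclic _ _ phiM kerphi c.
    by apply: (subsetP sHG); rewrite Hc cycle_id.
  by exists V0, E; rewrite szE /V Hc; split=> //; rewrite !muln_gt0 M_gt0.
have [V0 [E [sV0 V0V V_V0K EK szE]]] := preim_span_finite phiM kerphi sHG.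
by exists V0, E; rewrite szE; split=> //; apply: leq_mul.
Qed.

End Quotient.

(** * Subgroups of a direct product *)

Section SubdirectProduct.
Variables (A B : group) (U : subset_of (prod_group A B)).
Hypothesis sU : is_subgroup (prod_group A B) U.
Local Notation G := (prod_group A B).

Let mulU a b a' b' : U (a, b) -> U (a', b') -> U (gmul a a', gmul b b').
Proof. exact: (subM sU). Qed.

Let invU a b : U (a, b) -> U (ginv a, ginv b).
Proof. exact: (subV sU). Qed.

Let U1 : U (gone, gone).
Proof. exact: sub1 sU. Qed.

(** These are the P, Q and K of the proof idea, together with the slice in [A]; as in Goursat's
    lemma, each projection modulo its slice has the same order. *)
Definition proj_fst : subset_of A := fun a => exists b, U (a, b).
Definition proj_snd : subset_of B := fun b => exists a, U (a, b).
Definition slice_snd : subset_of B := fun b => U (gone, b).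
Definition slice_fst : subset_of A := fun a => U (a, gone).

Lemma proj_fst_subgroup : is_subgroup A proj_fst.
Proof.
split; first by exists gone.
split=> [x y [b Uxb] [b' Uyb']|x [b Uxb]]; first by exists (gmul b b'); apply: mulU.
by exists (ginv b); apply: invU.
Qed.

Lemma proj_snd_subgroup : is_subgroup B proj_snd.
Proof.
split; first by exists gone.
split=> [x y [b Uxb] [b' Uyb']|x [b Uxb]]; first by exists (gmul b b'); apply: mulU.
by exists (ginv b); apply: invU.
Qed.

Lemma slice_snd_subgroup : is_subgroup B slice_snd.
Proof.
split; first exact: U1.
split=> [x y Ux Uy|x Ux]; first by have := mulU Ux Uy; gsimp.
by have := invU Ux; rewrite ginv1.
Qed.

Lemma slice_fst_subgroup : is_subgroup A slice_fst.
Proof.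
split; first exact: U1.
split=> [x y Ux Uy|x Ux]; first by have := mulU Ux Uy; gsimp.
by have := invU Ux; rewrite ginv1.
Qed.

Lemma slice_snd_normal q x : proj_snd q -> slice_snd x ->
  slice_snd (gmul q (gmul x (ginv q))).
Proof.
move=> [a Uaq] Ux; have := mulU Uaq (mulU Ux (invU Uaq)).
by gsimp.
Qed.

Lemma subdirect_index n : has_index G (setT_g G) U n ->
  exists p q f, [/\ n = p * q * f,
    has_index A (setT_g A) proj_fst p /\ has_index B (setT_g B) proj_snd q,
    has_index B proj_snd slice_snd f,
    has_index G (fun z : G => snd z = gone)
      (setI_g G (fun z : G => snd z = gone) U) (p * f)
  & has_index G (fun z : G => fst z = gone)
      (setI_g G (fun z : G => fst z = gone) U) (q * f)].
Proof.
move=> Un.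
(* The three indices come from the chain G >= P x B >= P x Q >= U. *)
pose W : subset_of G := fun z => proj_fst z.1.
pose W' : subset_of G := fun z => proj_fst z.1 /\ proj_snd z.2.
have sP := proj_fst_subgroup; have sQ := proj_snd_subgroup.
have sW : is_subgroup G W.
  split; first exact: sub1 sP.
  by split=> [x y|x]; [apply: (subM sP) | apply: (subV sP)].
have sW' : is_subgroup G W'.
  split; first by split; [apply: sub1 sP | apply: sub1 sQ].
  split=> [x y [Px Qx] [Py Qy]|x [Px Qx]].
    by split; [apply: (subM sP) | apply: (subM sQ)].
  by split; [apply: (subV sP) | apply: (subV sQ)].
have UW' z : U z -> W' z by case: z => a b Uab; split; [exists b | exists a].
have W'W z : W' z -> W z by case.
have UW z : U z -> W z by move/UW'/W'W.
have [p [n1 [Wp Wn1 nE]]] := has_index_tower (subgroupT G) sW sU (fun _ _ => I) UW Un.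
have [q [f [Wq W'f n1E]]] := has_index_tower sW sW' sU W'W UW' Wn1.
have Pp : has_index A (setT_g A) proj_fst p.
  apply: (has_index_map (phi := fun a : A => (a, gone) : G) _ _ _ Wp) => // -[a b] _.
  by exists a => //; rewrite /W /= gmulV; apply: sub1 sP.
have Qq : has_index B (setT_g B) proj_snd q.
  apply: (has_index_map (phi := fun b : B => (gone, b) : G) _ _ _ Wq).
  - by move=> b _; apply: sub1 sP.
  - move=> b c _ _; split; first by case.
    by split=> //=; gsimp; apply: sub1 sP.
  - move=> [a b] Wa; exists b => //; split=> /=; last by rewrite gmulV; apply: sub1 sQ.
    by gsimp; apply: subV.
have Kf : has_index B proj_snd slice_snd f.
  apply: (has_index_map (phi := fun b : B => (gone, b) : G) _ _ _ W'f).
  - by move=> b Qb; split=> //; apply: sub1 sP.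
  - by move=> b c _ _; rewrite /= /pmul /=; gsimp.
  - move=> [a b] /= [Pa Qb].
    (* The coset of (a, b) modulo [U] also contains (1, bc) whenever (a^-1, c) is in [U], so all
       cosets of [U] in P x Q are represented inside Q. *)
    have [c Uc] := subV sP Pa; have Qc : proj_snd c by exists (ginv a).
    by exists (gmul b c); [apply: (subM sQ) | rewrite /pmul /=; gsimp].
have Kf' : has_index A proj_fst slice_fst f.
  apply: (has_index_map (phi := fun a : A => (a, gone) : G) _ _ _ W'f).
  - by move=> a Pa; split=> //; apply: sub1 sQ.
  - by move=> b c _ _; rewrite /= /pmul /=; gsimp.
  - move=> [a b] /= [Pa Qb].
    have [c Uc] := subV sQ Qb; have Pc : proj_fst c by exists (ginv b).
    by exists (gmul a c); [apply: (subM sP) | rewrite /pmul /=; gsimp].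
exists p, q, f; split=> //; first by rewrite nE n1E mulnA.
  have KP x : slice_fst x -> proj_fst x by move=> Ux; exists gone.
  have := has_index_mul (subgroupT A) sP slice_fst_subgroup (fun _ _ => I) KP Pp Kf'.
  apply: (has_index_map (phi := fst : G -> A)) => // [[a b] [a' b'] /= -> ->|a _].
    by rewrite /setI_g /= /pmul /=; gsimp; split=> [|[]].
  by exists (a, gone) => //=; rewrite gmulV; apply: sub1 slice_fst_subgroup.
have KQ x : slice_snd x -> proj_snd x by move=> Ux; exists gone.
have := has_index_mul (subgroupT B) sQ slice_snd_subgroup (fun _ _ => I) KQ Qq Kf.
apply: (has_index_map (phi := snd : G -> B)) => // [[a b] [a' b'] /= -> ->|b _].
  by rewrite /setI_g /= /pmul /=; gsimp; split=> [|[]].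
by exists (gone, b) => //=; rewrite gmulV; apply: sub1 slice_snd_subgroup.
Qed.

(* Lifts of generators of both projections generate a subgroup of [U] projecting
   onto both factors, which therefore normalises [slice_snd]. *)
Lemma subdirect_generates SP SQ R :
    generates A proj_fst SP -> generates B proj_snd SQ ->
    (forall x, In x R -> slice_snd x) ->
    (forall L, is_subgroup B L ->
      (forall q x, proj_snd q -> L x -> L (gmul q (gmul x (ginv q)))) ->
      (forall x, In x R -> L x) -> forall x, slice_snd x -> L x) ->
  exists2 S, length S = length SP + length SQ + length R & generates G U S.
Proof.
move=> [SPP genP] [SQQ genQ] RK genR.
have [s /SPP//|lP [szP lPU PlP]] := @list_choice _ _ (fun a z => U z /\ z.1 = a) SP.
  by move=> [b Uab]; exists (s, b).
have [s /SQQ//|lQ [szQ lQU QlQ]] := @list_choice _ _ (fun b z => U z /\ z.2 = b) SQ.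
  by move=> [a Uab]; exists (a, s).
exists (lP ++ lQ ++ map (pair gone) R)%list.
  by rewrite !length_app length_map szP szQ; lia.
split=> [z|L sL SL z Uz].
  case/in_app_iff=> [/lPU[s _ []//]|/in_app_iff[/lQU[s _ []//]|/in_map_iff[x [<-]]]].
  exact: RK.
pose L' := setI_g G L U.
have sL' : is_subgroup G L' by apply: subgroupI.
have L'P x : proj_fst x -> exists b, L' (x, b).
  move: x; apply: genP => [|s /PlP[[a b] lPz [Uab /= <-]]].
    split; first by exists gone; apply: sub1 sL'.
    split=> [x y [b Lb] [c Lc]|x [b Lb]]; first by exists (gmul b c); apply: (subM sL' Lb Lc).
    by exists (ginv b); apply: (subV sL' Lb).
  by exists b; split=> //; apply: SL; apply/in_app_iff; left.
have L'Q x : proj_snd x -> exists a, L' (a, x).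
  move: x; apply: genQ => [|s /QlQ[[a b] lQz [Uab /= <-]]].
    split; first by exists gone; apply: sub1 sL'.
    split=> [x y [b Lb] [c Lc]|x [b Lb]]; first by exists (gmul b c); apply: (subM sL' Lb Lc).
    by exists (ginv b); apply: (subV sL' Lb).
  exists a; split=> //; apply: SL; apply/in_app_iff; right.
  by apply/in_app_iff; left.
have KL x : slice_snd x -> L' (gone, x).
  move: x; apply: genR.
  - split; first exact: sub1 sL'.
    split=> [x y Lx Ly|x Lx]; first by have := subM sL' Lx Ly; rewrite /= /pmul /=; gsimp.
    by have := subV sL' Lx; rewrite /= /pinv /= ginv1.
  - move=> q x /L'Q[a La] Lx; have := subM sL' La (subM sL' Lx (subV sL' La)).
    by rewrite /= /pmul /pinv /=; gsimp.
  move=> x Rx; split; last exact: RK.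
  apply: SL; apply/in_app_iff; right; apply/in_app_iff; right.
  exact: in_map.
(* Divide (a, b) by an element (a, c) of both [L] and [U]: the quotient lies in the slice, hence in
   [L]. *)
case: z Uz => a b Uab; have [c [Lac Uac]] : exists c, L' (a, c) by apply: L'P; exists b.
have /KL[Lcb _] : slice_snd (gmul (ginv c) b).
  by have := mulU (invU Uac) Uab; gsimp.
by have := subM sL Lac Lcb; rewrite /= /pmul /=; gsimp.
Qed.

(** The two indices are q f and p f. In the lower bound on p f, the first summand forces p >= M when
    f <= M^(M+1), and the second absorbs the M^4 additional normal generators. *)
Lemma d_bound SA SB n M :
    generates A (setT_g A) SA -> generates B (setT_g B) SB ->
    has_index G (setT_g G) U n -> 0 < M ->
    M <= index G (fun z : G => fst z = gone)
           (setI_g G (fun z : G => fst z = gone) U) ->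
    M * (M ^ M.+1).+1 + M * (M * M * (M * M)) <= index G (fun z : G => snd z = gone)
           (setI_g G (fun z : G => snd z = gone) U) ->
  M <= n /\ d G U * M <= n * (length SA + length SB + length SB + 1).
Proof.
move=> genA genB Un M_gt0.
have [p [q [f [nE [Pp Qq] Kf Aidx Bidx]]]] := subdirect_index Un.
rewrite (indexE Aidx) (indexE Bidx) => le_M le_M1.
have sP := proj_fst_subgroup; have sQ := proj_snd_subgroup.
have [SP szP genP] := schreier (subgroupT A) sP (fun _ _ => I) genA Pp.
have [SQ szQ genQ] := schreier (subgroupT B) sQ (fun _ _ => I) genB Qq.
have KQ x : slice_snd x -> proj_snd x by move=> Ux; exists gone.
have [m [h [R [fE h_large szR RK genR]]]] :=
  normal_generators_bound sQ slice_snd_subgroup KQ slice_snd_normal M_gt0 genQ Kf.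
have [S szS genS] := subdirect_generates genP genQ RK genR.
have dS : d G U <= length S by apply/leP; apply: d_le.
have /andP[p_gt0 f_gt0] : (0 < p) && (0 < f) by rewrite -muln_gt0; lia.
have /andP[q_gt0 _] : (0 < q) && (0 < f) by rewrite -muln_gt0; lia.
have /andP[m_gt0 h_gt0] : (0 < m) && (0 < h) by rewrite -muln_gt0 -fE.
(* If [h] < [M] and [p] < [M], then p f <= M * M^(M+1), against the lower bound on p f. *)
have le_Mph : M <= p * h.
  case: h_large => [le_Mh|f_small]; first exact: leq_trans le_Mh (leq_pmull _ _).
  have [le_Mp|lt_pM] := leqP M p; first exact: leq_trans le_Mp (leq_pmulr _ _).
  have := leq_mul (ltnW lt_pM) f_small; move: le_M1; rewrite mulnS; lia.
have le_Mpf : M <= p * f.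
  by apply: leq_trans le_Mph _; rewrite leq_mul2l fE leq_pmull ?orbT.
split; first by rewrite nE mulnAC (leq_trans le_Mpf) ?leq_pmulr.
apply: leq_trans (leq_mul dS (leqnn M)) _.
rewrite szS szP szQ nE; rewrite szQ in szR; set e := M * M * (M * M) in szR le_M1.
(* The four groups of generators are bounded separately: lifts from P by M <= q f, lifts from Q by M
   <= p f, the Schreier part of [R] by M <= p h, and the M^4 others by the bound on p f. *)
have bA : length SA * p * M <= p * q * f * length SA.
  have := leq_mul (leqnn (length SA * p)) le_M; lia.
have bB : length SB * q * M <= p * q * f * length SB.
  have := leq_mul (leqnn (length SB * q)) le_Mpf; lia.
have bR : length SB * q * m * M <= p * q * f * length SB.
  have := leq_mul (leqnn (length SB * q * m)) le_Mph; rewrite fE; lia.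
have be : e * M <= p * q * f.
  have: p * f <= p * q * f by rewrite mulnAC leq_pmulr.
  by move: le_M1; rewrite (mulnC e); lia.
have := leq_mul szR (leqnn M); rewrite !mulnDl !mulnDr muln1; lia.
Qed.

End SubdirectProduct.

(** * From the explicit bound to the limit *)

Open Scope R_scope.

Theorem theorem1p1 (A B : group) (U : nat -> subset_of (prod_group A B)) :
  fin_gen A (setT_g A) ->
  fin_gen B (setT_g B) ->
  (forall n, is_subgroup (prod_group A B) (U n)) ->
  (forall n, finite_index (prod_group A B) (setT_g (prod_group A B)) (U n)) ->
  tends_to_infty (fun n =>
    index (prod_group A B) (fun p : prod_group A B => snd p = gone)
          (setI_g (prod_group A B) (fun p : prod_group A B => snd p = gone) (U n))) ->
  tends_to_infty (fun n =>
    index (prod_group A B) (fun p : prod_group A B => fst p = gone)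
          (setI_g (prod_group A B) (fun p : prod_group A B => fst p = gone) (U n))) ->
  Un_cv (fun n => (INR (d (prod_group A B) (U n)) - 1)
                   / INR (index (prod_group A B) (setT_g (prod_group A B)) (U n))) 0.
Proof.
move=> [SA genA] [SB genB] sU fU Ainf Binf eps eps_gt0.
pose C := (length SA + length SB + length SB + 1)%N.
(* With I the index, D M <= I C and M <= I give (D + 1) M <= I (C + 1) < I M eps; D + 1 dominates
   the absolute value of D - 1. *)
have [M M_large] := INR_unbounded ((INR C + 1) / eps).
have C_ge0 := pos_INR C.
have M_gt0 : 0 < INR M.
  by apply: Rlt_trans M_large; apply: Rdiv_lt_0_compat; lra.
have M_pos : (0 < M)%N by apply/ltP; apply: INR_lt.
have [N1 leN1] := Ainf (M * (M ^ M.+1).+1 + M * (M * M * (M * M)))%N.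
have [N2 leN2] := Binf M.
exists (N1 + N2)%coq_nat => n le_n.
have [I UI] := fU n; rewrite (indexE UI).
have [|| /leP/le_INR M_I /leP/le_INR] := d_bound (sU n) genA genB UI M_pos.
- by apply/leP/leN2; lia.
- by apply/leP/leN1; lia.
rewrite -/C !mult_INR; set D := INR (d _ _) => dM.
have D_ge0 : 0 <= D := pos_INR _.
have I_gt0 : 0 < INR I by lra.
have M_eps : INR C + 1 < INR M * eps.
  by have := Rmult_lt_compat_r _ _ _ eps_gt0 M_large; rewrite /Rdiv Rmult_assoc Rinv_l ?Rmult_1_r; lra.
rewrite /R_dist Rminus_0_r /Rdiv Rabs_mult (Rabs_pos_eq (/ _)); last first.
  exact/Rlt_le/Rinv_0_lt_compat.
apply: (Rmult_lt_reg_r (INR I * INR M)); first exact: Rmult_lt_0_compat.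
have -> : Rabs (D - 1) * / INR I * (INR I * INR M) = Rabs (D - 1) * INR M by field; lra.
have abs_le : Rabs (D - 1) <= D + 1 by apply: Rabs_le; lra.
have := Rmult_le_compat_r _ _ _ (Rlt_le _ _ M_gt0) abs_le.
have := Rmult_lt_compat_l _ _ _ I_gt0 M_eps.
lra.
Qed.
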